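(* Let $Q$ be a finite quasi-affine quandle. The following statements are equivalent: (1) $Q$ is affine; (2) for every $x\in Q$ and every $y_1,y_2\in Qx$, $m_{x,y_1}=m_{x,y_2}$; (3) there exists $x\in Q$ such that for every $y_1,y_2\in Qx$, $m_{x,y_1}=m_{x,y_2}$.
   Context: A quandle is a nonempty set $Q$ with a binary operation $*$ such that $x*x=x$; for all $x,y$ there is a unique $z$ with $x*z=y$; and $x*(y*z)=(x*y)*(x*z)$. With left translations $L_x(y)=x*y$, let $\mathrm{Dis}(Q)=\langle L_aL_b^{-1}:a,b\in Q\rangle$; the orbit of $x$ is $Qx=\{\alpha(x):\alpha\in\mathrm{Dis}(Q)\}$. For $x,y\in Q$, $m_{x,y}=|\{z\in Q: z*x=y\}|$. For an abelian group $A$ and $f\in\mathrm{Aut}(A)$, $\mathrm{Aff}(A,f)$ is the quandle on $A$ with $a*b=(1-f)(a)+f(b)$ ($1$ is the identity map). A quandle is affine if it is isomorphic to some $\mathrm{Aff}(A,f)$, and quasi-affine if it is isomorphic to a subquandle of an affine quandle. *)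

(* Defs.v *)
From HB Require Import structures.
From mathcomp Require Import all_boot all_fingroup all_algebra.

Set Implicit Arguments.
Unset Strict Implicit.
Unset Printing Implicit Defensive.

Import GRing.Theory.

HB.mixin Record isQuandle (T : Type) := {
  qop : T -> T -> T;
  quandle_nonempty : inhabited T;
  qopxx : forall x, qop x x = x;
  qop_ldiv : forall x y, exists! z, qop x z = y;
  qop_ldistr : forall x y z, qop x (qop y z) = qop (qop x y) (qop x z)
}.

#[short(type="quandleType")]
HB.structure Definition Quandle := { T of isQuandle T }.

#[short(type="finQuandleType")]
HB.structure Definition FinQuandle := { T of Finite T & isQuandle T }.

Declare Scope quandle_scope.
Delimit Scope quandle_scope with Q.
Reserved Notation "x |> y" (at level 40, left associativity).
Notation "x |> y" := (qop x y) : quandle_scope.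
Local Open Scope quandle_scope.

Definition quandle_isomorphic (P Q : quandleType) : Prop :=
  exists2 h : P -> Q, bijective h & {morph h : x y / x |> y}.

Section AffineQuandle.
Variables (A : zmodType) (f : {additive A -> A}) (f_bij : bijective f).
Local Open Scope ring_scope.

Definition Aff_op (a b : A) : A := (a - f a) + f b.

(* The carrier is [A]; the proof [f_bij] only serves to make [Aff f_bij]
   a quandle. *)
Definition Aff : Type := let _ := f_bij in A.

Lemma Aff_nonempty : inhabited A.
Proof. exact: (inhabits 0). Qed.

Lemma Aff_opxx a : Aff_op a a = a.
Proof. exact: subrK. Qed.

Lemma Aff_op_ldiv a b : exists! c, Aff_op a c = b.
Proof.
case: f_bij => g fK gK; exists (g (b - (a - f a))); split=> [|c <-].
  by rewrite /Aff_op gK addrC subrK.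
by rewrite /Aff_op (addrC (_ + f c)) addKr fK.
Qed.

Lemma Aff_op_ldistr a b c :
  Aff_op a (Aff_op b c) = Aff_op (Aff_op a b) (Aff_op a c).
Proof.
rewrite /Aff_op (raddfD f (a - f a) (f b)) (raddfD f (a - f a) (f c)).
rewrite (raddfD f (b - f b)) raddfB; set v := f (a - f a).
rewrite [v + f (f b)]addrC opprD -!addrA; congr (_ + (_ + (_ + _))).
by rewrite addKr.
Qed.

HB.instance Definition _ :=
  isQuandle.Build Aff Aff_nonempty Aff_opxx Aff_op_ldiv Aff_op_ldistr.

End AffineQuandle.

Definition affine (Q : quandleType) : Prop :=
  exists (A : zmodType) (f : {additive A -> A}) (f_bij : bijective f),
    quandle_isomorphic Q (Aff f_bij).

Definition is_subquandle (Q : quandleType) (S : {pred Q}) : Prop :=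
  [/\ exists x, x \in S,
      forall x y, x \in S -> y \in S -> x |> y \in S
    & forall x y, x \in S -> y \in S -> exists2 z, z \in S & x |> z = y].

Section Subquandle.
Variables (Q : quandleType) (S : {pred Q}) (S_sub : is_subquandle S).

Definition subquandle : Type := let _ := S_sub in {x : Q | x \in S}.

Definition subquandle_op (x y : {x : Q | x \in S}) : {x : Q | x \in S} :=
  let: And3 _ S_op _ := S_sub in
  exist _ (val x |> val y) (S_op _ _ (valP x) (valP y)).

Lemma val_subquandle_op x y : val (subquandle_op x y) = val x |> val y.
Proof. by rewrite /subquandle_op; case: S_sub. Qed.

Lemma subquandle_nonempty : inhabited {x : Q | x \in S}.
Proof. by case: S_sub => -[x Sx] _ _; exact: (inhabits (exist _ x Sx)). Qed.

Lemma subquandle_opxx x : subquandle_op x x = x.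
Proof. by apply: val_inj; rewrite val_subquandle_op qopxx. Qed.

Lemma subquandle_op_ldiv x y : exists! z, subquandle_op x z = y.
Proof.
case: (S_sub) => _ _ S_div.
have [z Sz xz] := S_div _ _ (valP x) (valP y).
exists (exist _ z Sz); split=> [|t xt]; apply: val_inj.
  by rewrite val_subquandle_op.
have [u [_ u_uniq]] := qop_ldiv (val x) (val y).
by rewrite /= -(u_uniq z xz) -(u_uniq (val t)) // -val_subquandle_op xt.
Qed.

Lemma subquandle_op_ldistr x y z :
  subquandle_op x (subquandle_op y z) =
  subquandle_op (subquandle_op x y) (subquandle_op x z).
Proof. by apply: val_inj; rewrite !val_subquandle_op qop_ldistr. Qed.

HB.instance Definition _ :=
  isQuandle.Build subquandle subquandle_nonempty subquandle_opxx
    subquandle_op_ldiv subquandle_op_ldistr.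

End Subquandle.

Definition quasi_affine (Q : quandleType) : Prop :=
  exists (B : quandleType) (S : {pred B}) (S_sub : is_subquandle S),
    affine B /\ quandle_isomorphic Q (subquandle S_sub).

Section Displacement.
Variable Q : finQuandleType.
Local Open Scope group_scope.

Lemma qop_inj (x : Q) : injective (qop x).
Proof.
move=> y z eq_xyz; have [t [_ t_uniq]] := qop_ldiv x (x |> z)%Q.
by rewrite -(t_uniq y eq_xyz) -(t_uniq z).
Qed.

Definition ltrans (x : Q) : {perm Q} := perm (@qop_inj x).

(* Products in [{perm Q}] are composed from left to right: the permutation
   y |-> L_a (L_b^-1 y) is [(ltrans b)^-1 * ltrans a]. *)
Definition Dis : {group {perm Q}} :=
  [group of <<[set (ltrans ab.2)^-1 * ltrans ab.1 | ab : Q * Q]>>].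

Definition qorbit (x : Q) : {set Q} := orbit 'P Dis x.

Definition qmult (x y : Q) : nat := #|[set z : Q | (z |> x)%Q == y]|.

End Displacement.

(* Main.v *)
Require Import Defs.
From HB Require Import structures.
From mathcomp Require Import all_boot all_fingroup all_algebra.

Set Implicit Arguments.
Unset Strict Implicit.
Unset Printing Implicit Defensive.

(** Embed [Q] into [Aff A f] by [e : Q -> A] and put [phi := 1 - f].  Every
displacement acts on [Q] as a translation by an element of [phi A], so the
orbit of [x] is a coset, under [e], of a finite subgroup [D] of [A], and all
orbits are cosets of this same [D].  The equation [z |> x = y] reads
[phi (e z - e x) = e y - e x].

If [e] is onto, its solution sets, for [y] in the orbit of [x], are translates
of each other: this is the easy half, [affine_qmult].

Conversely fix [x0] and let [r z := phi (e z - e x0)], a map from [Q] to [D].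
Uniform multiplicities say that all the fibres of [r] have the same size.
Moreover [D] acts freely on [Q] by translations, [r (z + a) = r z + phi a],
and [a |> b = b + (r a - r b)].  So it is enough to find a finite abelian
group [B] containing [D], an extension [psi : B -> D] of the restriction of
[phi] to [D], and a bijection [h : Q -> B] which commutes with the translations
by [D] and satisfies [psi (h z) = r z]: then [h] is an isomorphism of [Q] onto
[Aff B g] with [g := 1 - psi].  This [g] is injective, for [psi b = b] puts
[b] in [D] and gives [f b = 0].  In general [A] cannot serve as [B]: the kernel
of [phi] on [A] is unrelated to the number of orbits.

Such a [B] is obtained in two steps.

- [surjective_extension]: there are [B0] containing [D] and a surjective
  [psi : B0 -> D] extending [phi] without enlarging the kernel.  In homological
  terms, the extension of [phi D] by [ker phi] given by [D] lifts to an
  extension of [D], since Ext^2 vanishes over the integers.  Concretely, one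
  enlarges the image of [psi] by one cyclic generator at a time.

- [ker phi] acts freely on the fibres of [r], so their common size is
  [k * #|ker phi|] for some [k].  In [B := B0 x Z/k] the fibres of [psi] have
  that size too, and two finite sets with free [D]-actions and fibres of equal
  sizes over [D] are matched orbit by orbit ([equivariant_matching]). *)

Import GRing.Theory.
Local Open Scope quandle_scope.
Local Open Scope ring_scope.

(** Proves an identity between sums of atoms in an abelian group by moving a
term and its opposite to the end of the sum, where they cancel.  The number of
moves is bounded because a term that occurs twice could be moved forever; the
leading zero ensures that even the first term has a left neighbour. *)
Ltac zmod_cancel :=
  apply: subr0_eq; rewrite -[LHS]add0r;
  rewrite ?(opprB, opprD, opprK) ?addrA;
  repeat match goal with
  | |- context [- ?x] =>
    do 15 ?rewrite (addrAC _ (- x) _);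
    do 15 ?rewrite (addrAC _ x _);
    rewrite subrK
  end; rewrite ?addr0.

(** * Cyclic extensions of finite abelian groups *)

Section CyclicExtension.

Variables (Y : finZmodType) (y : Y) (n : nat).

(** The quotient of [Y x Z] by the subgroup generated by [(- y, n.+1)], where
each class is represented by its element with second component in [0, n]:
addition then produces a carry, which is a multiple of [y].  For [y = 0] this
is the direct product of [Y] and [Z/n.+1]. *)
Definition cyclic_ext : Type := let _ := y in (Y * 'I_n.+1)%type.

HB.instance Definition _ := Finite.on cyclic_ext.

Definition cyclic_ext_zero : cyclic_ext := (0, 0).

Definition cyclic_ext_add (u v : cyclic_ext) : cyclic_ext :=
  (u.1 + v.1 + y *+ ((u.2 + v.2) %/ n.+1)%N, u.2 + v.2).

Definition cyclic_ext_opp (u : cyclic_ext) : cyclic_ext :=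
  (- u.1 - y *+ ((u.2 + (- u.2)%R) %/ n.+1)%N, - u.2).

(** Both sides count the carries of [a + b + c]; this 2-cocycle identity gives
associativity. *)
Lemma carry_cocycle (a b c : 'I_n.+1) :
  ((a + b) %/ n.+1 + ((a + b)%R + c) %/ n.+1 = (a + b + c) %/ n.+1)%N.
Proof. by rewrite -divnMDl // addnA -divn_eq. Qed.

Lemma cyclic_ext_addC : commutative cyclic_ext_add.
Proof.
by move=> u v; rewrite /cyclic_ext_add addnC [u.1 + _]addrC [u.2 + _]addrC.
Qed.

Lemma cyclic_ext_addA : associative cyclic_ext_add.
Proof.
move=> u v w; rewrite /cyclic_ext_add; congr (_, _); last exact: addrA.
rewrite /= !addrA [in RHS](addrAC (u.1 + v.1)) -!addrA -!mulrnDr.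
do 3 congr (_ + _); congr (_ *+ _).
by rewrite [(u.2 + (v.2 + w.2)%R)%N]addnC !carry_cocycle addnC addnA.
Qed.

Lemma cyclic_ext_add0 : left_id cyclic_ext_zero cyclic_ext_add.
Proof.
by move=> [u i]; rewrite /cyclic_ext_add /= !add0r add0n divn_small // addr0.
Qed.

Lemma cyclic_ext_addN :
  left_inverse cyclic_ext_zero cyclic_ext_opp cyclic_ext_add.
Proof.
move=> u; rewrite cyclic_ext_addC /cyclic_ext_add /= !addrA subrr sub0r.
by rewrite addNr subrr.
Qed.

HB.instance Definition _ := GRing.isZmodule.Build cyclic_ext
  cyclic_ext_addA cyclic_ext_addC cyclic_ext_add0 cyclic_ext_addN.

Definition cyclic_ext_inj (u : Y) : cyclic_ext := (u, 0).

Lemma cyclic_ext_inj_morph : nmod_morphism cyclic_ext_inj.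
Proof.
by split=> // u v; congr (_, _); rewrite /= ?addr0 // divn_small // addr0.
Qed.

HB.instance Definition _ :=
  GRing.isNmodMorphism.Build Y cyclic_ext cyclic_ext_inj cyclic_ext_inj_morph.

Variables (D : zmodType) (p : {additive Y -> D}) (d : D).
Hypothesis py : p y = d *+ n.+1.

Definition cyclic_ext_lift (u : cyclic_ext) : D :=
  let _ := py in p u.1 + d *+ u.2.

Lemma cyclic_ext_lift_morph : nmod_morphism cyclic_ext_lift.
Proof.
split=> [|u v]; rewrite /cyclic_ext_lift /=; first by rewrite raddf0 addr0.
rewrite !raddfD raddfMn py -mulrnA -addrA -mulrnDr mulnC -divn_eq mulrnDr.
by rewrite addrACA.
Qed.

HB.instance Definition _ := GRing.isNmodMorphism.Build cyclic_ext D
  cyclic_ext_lift cyclic_ext_lift_morph.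

Lemma cyclic_ext_lift_inj u : cyclic_ext_lift (cyclic_ext_inj u) = p u.
Proof. exact: addr0. Qed.

End CyclicExtension.

(** As long as [p : Y -> D] misses some [d], let [m] be the least positive
integer such that [m d] is in the image, say [m d = p y]; adjoin to [Y] a
generator [t] with [m t = y], and send it to [d].  No new kernel appears,
since by minimality of [m] an element [u + i t] with [0 < i < m] cannot be
mapped to zero. *)
Lemma surjective_extension (D : finZmodType) (phi : {additive D -> D}) :
  exists (B : finZmodType) (j : {additive D -> B}) (psi : {additive B -> D}),
    [/\ injective j, forall d, psi (j d) = phi d,
        forall b, psi b = 0 -> exists d, b = j d
      & forall d, exists b, psi b = d].
Proof.
suff extend c : forall (Y : finZmodType) (j : {additive D -> Y})
    (p : {additive Y -> D}), (#|[set d | d \notin codom p]| < c)%N ->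
    injective j -> (forall d, p (j d) = phi d) ->
    (forall b, p b = 0 -> exists d, b = j d) ->
  exists (B : finZmodType) (j : {additive D -> B}) (psi : {additive B -> D}),
    [/\ injective j, forall d, psi (j d) = phi d,
        forall b, psi b = 0 -> exists d, b = j d
      & forall d, exists b, psi b = d].
  apply: (extend _ D idfun phi (ltnSn _)) => //= b _.
  by exists b.
elim: c => // c IHc Y j p lt_c j_inj pj kerp.
have [/forallP p_surj | ] := boolP [forall d, d \in codom p].
  exists Y, j, p; split=> // d.
  by have /codomP[b ->] := p_surj d; exists b.
rewrite negb_forall => /existsP[d d_notin].
have ex_m : exists m, d *+ m.+1 \in codom p.
  exists #[d]%g.-1; rewrite prednK ?order_gt0 // -FinRing.zmodXgE expg_order.
  by rewrite -[1%g]/(0 : D) -(raddf0 p) codom_f.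
case: (ex_minnP ex_m) => n /codomP[y py] n_min.
have n_gt0 : (0 < n)%N.
  by rewrite lt0n; apply: contraNneq d_notin => n0; rewrite n0 in py;
     rewrite -[d]mulr1n py codom_f.
pose p' := cyclic_ext_lift (esym py).
apply: (IHc (cyclic_ext y n) (@cyclic_ext_inj _ y n \o j : {additive _ -> _}) p').
- rewrite -ltnS; apply: leq_trans lt_c; rewrite ltnS; apply: proper_card.
  apply/properP; split.
    apply/subsetP=> x; rewrite !inE; apply: contra => /codomP[b ->].
    by rewrite -(cyclic_ext_lift_inj (esym py)) codom_f.
  exists d; rewrite !inE // negbK; apply/codomP.
  exists (0, inord 1); rewrite /p' /= /cyclic_ext_lift /= raddf0 add0r.
  by rewrite inordK.
- by move=> a b [/j_inj].
- by move=> a; rewrite /= cyclic_ext_lift_inj pj.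
move=> [u [[|i] lt_i]]; rewrite /= /cyclic_ext_lift /=.
  rewrite addr0 => /kerp[a ->]; exists a; congr (_, _).
  exact: val_inj.
move=> /eqP; rewrite addr_eq0 => /eqP pu.
have : (n <= i)%N; last by rewrite leqNgt -ltnS lt_i.
by apply: n_min; rewrite -[d *+ _]opprK -pu -(raddfN p) codom_f.
Qed.

(** * Matching free actions *)

Section FreeActions.

Variable D : finZmodType.

Definition free_action (P : Type) (act : P -> D -> P) :=
  [/\ forall x, act x 0 = x,
      forall x a b, act x (a + b) = act (act x a) b
    & forall x a, act x a = x -> a = 0].

Section OneAction.

Variables (P : finType) (act : P -> D -> P) (act_free : free_action act).

Definition stable (U : {set P}) := forall x a, x \in U -> act x a \in U.

Definition free_orbit x := [set act x a | a : D].

Lemma free_action_inj x : injective (act x).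
Proof.
case: act_free => act0 actD free a b eq_ab; apply/eqP; rewrite -subr_eq0.
by apply/eqP/(free x); rewrite actD eq_ab -actD subrr act0.
Qed.

Lemma stableD U s : stable U -> stable (U :\: free_orbit s).
Proof.
case: act_free => act0 actD _ stU x a /setDP[Ux not_sx].
rewrite inE stU // andbT; apply: contra not_sx => /imsetP[b _ xa].
apply/imsetP; exists (b - a) => //.
by rewrite actD -xa -actD subrr act0.
Qed.

Lemma free_orbit_refl s : s \in free_orbit s.
Proof. by apply/imsetP; exists 0; case: act_free. Qed.

(** A stable set is a disjoint union of free orbits, which can be removed one
at a time. *)
Lemma stable_ind (K : {set P} -> Prop) :
    K set0 ->
    (forall U s, stable U -> s \in U -> K (U :\: free_orbit s) -> K U) ->
  forall U, stable U -> K U.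
Proof.
move=> K0 Korb U; have [c] := ubnP #|U|; elim: c U => // c IHc U le_c stU.
have [-> // | [s Us]] := set_0Vmem U.
apply: (Korb U s) => //; apply: IHc; last exact: stableD.
rewrite -ltnS; apply: leq_trans le_c; rewrite ltnS; apply: proper_card.
apply/properP; split; first exact: subsetDl.
by exists s; rewrite // inE free_orbit_refl.
Qed.

Variables (phi : {additive D -> D}) (r : P -> D).
Hypothesis r_act : forall x a, r (act x a) = r x + phi a.

(** The part of the fibre contained in the orbit of [s] depends only on
[r s]: this is what makes the removal of an orbit harmless, both for
divisibility and for matching. *)
Lemma card_fiber_orbit U s d : stable U -> s \in U ->
  #|[set x in U | r x == d]| =
    (#|[set x in U :\: free_orbit s | r x == d]|
       + #|[set a | phi a == (d - r s)%R]|)%N.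
Proof.
move=> stU Us; rewrite -(cardsID (free_orbit s)) addnC; congr (_ + _)%N.
  by apply: eq_card => x; rewrite !inE andbA.
rewrite -(card_imset _ (@free_action_inj s)); apply: eq_card => x.
rewrite !inE; apply/andP/imsetP => [[/andP[Ux /eqP <-] /imsetP[a _ ->]]|].
  by exists a; rewrite // inE r_act addrC addKr.
case=> a; rewrite inE => /eqP phia ->.
by rewrite stU // r_act phia addrC subrK eqxx; split=> //; apply/imsetP; exists a.
Qed.

End OneAction.

Lemma card_fiber (B E : finZmodType) (p : {additive B -> E}) b :
  #|[set a | p a == p b]| = #|[set a | p a == 0]|.
Proof.
rewrite -(card_imset _ (addIr (- b))); apply: eq_card => x; rewrite !inE.
apply/imsetP/eqP => [[a] | px0].
  by rewrite inE => /eqP pab ->; rewrite raddfB pab subrr.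
by exists (x + b); rewrite ?addrK // inE raddfD px0 add0r.
Qed.

(** The fibre meets each orbit either in the empty set or in the translates of
a point by the kernel of [phi]. *)
Lemma dvdn_card_ker_fiber (P : finType) (act : P -> D -> P)
    (phi : {additive D -> D}) (r : P -> D) (d : D) :
    free_action act -> (forall x a, r (act x a) = r x + phi a) ->
  (#|[set a | phi a == 0%R]| %| #|[set x | r x == d]|)%N.
Proof.
move=> act_free r_act.
have -> : [set x | r x == d] = [set x in [set: P] | r x == d].
  by apply/setP=> x; rewrite !inE.
move: [set: P] (fun x a (_ : x \in [set: P]) => in_setT (act x a)).
apply: (stable_ind act_free) => [|U s stU Us IH].
  by rewrite (_ : [set x in set0 | _] = set0) ?cards0 ?dvdn0 //;
     apply/setP=> x; rewrite !inE.
rewrite (card_fiber_orbit act_free r_act _ stU Us) dvdn_addr ?IH //.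
have [-> | [a]] := set_0Vmem [set a | phi a == d - r s].
  by rewrite cards0 dvdn0.
by rewrite inE => /eqP <-; rewrite card_fiber.
Qed.

(** Greedy construction: an orbit of [P] is sent to an orbit of [R] through a
point with the same value of [r]; removing both leaves fibres of equal sizes.
The point [y0] only provides a value for [h] outside the stable sets of the
induction. *)
Lemma equivariant_matching (P R : finType)
    (actP : P -> D -> P) (actR : R -> D -> R) (phi : {additive D -> D})
    (rP : P -> D) (rR : R -> D) (y0 : R) :
    free_action actP -> free_action actR ->
    (forall x a, rP (actP x a) = rP x + phi a) ->
    (forall y a, rR (actR y a) = rR y + phi a) ->
    (forall d, #|[set x | rP x == d]| = #|[set y | rR y == d]|) ->
  exists h : P -> R,
    [/\ bijective h, forall x a, h (actP x a) = actR (h x) a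
      & forall x, rR (h x) = rP x].
Proof.
move=> freeP freeR rPact rRact card_eq.
suff match_on : forall U, stable actP U -> forall V, stable actR V ->
    (forall d, #|[set x in U | rP x == d]| = #|[set y in V | rR y == d]|) ->
  exists h : P -> R,
    [/\ {in U, forall x, h x \in V /\ rR (h x) = rP x},
        {in U, forall x a, h (actP x a) = actR (h x) a} & {in U &, injective h}].
  have [||d|h [h_r h_act h_inj]] := match_on setT _ setT.
  - by move=> x a _; rewrite inE.
  - by move=> x a _; rewrite inE.
  - rewrite (_ : [set x in _ | _] = [set x | rP x == d]) ?card_eq.
      by apply: eq_card => y; rewrite !inE.
    by apply/setP=> x; rewrite !inE.
  exists h; split=> [|x a|x].
  - apply: inj_card_bij => [x y|]; first by apply: h_inj; rewrite inE.
    rewrite -!sum1_card (partition_big rP predT) //=.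
    rewrite [X in (X <= _)%N](partition_big rR predT) //=.
    apply: leq_sum => d _; rewrite !sum1_card -[X in (_ <= X)%N]cardsE.
    by rewrite -[X in (X <= _)%N]cardsE; have := card_eq d; move=> ->.
  - by apply: h_act; rewrite inE.
  - by case: (h_r x); rewrite ?inE.
apply: (stable_ind freeP) => [|U s stU Us IH] V stV card_UV.
  by exists (fun=> y0); split=> x; rewrite inE.
have [t] : exists t, t \in [set y in V | rR y == rP s].
  apply/set0Pn; rewrite -card_gt0 -card_UV card_gt0; apply/set0Pn.
  by exists s; rewrite inE Us eqxx.
rewrite inE => /andP[Vt /eqP rt].
have [|d|h [h_r h_act h_inj]] := IH (V :\: free_orbit actR t).
- exact: stableD.
- apply/eqP; rewrite -(eqn_add2r #|[set a | phi a == (d - rP s)]|).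
  rewrite -(card_fiber_orbit freeP rPact _ stU Us) card_UV.
  by rewrite (card_fiber_orbit freeR rRact _ stV Vt) rt.
pose g x := if [pick a | x == actP s a] is Some a then actR t a else h x.
have g_orb a : g (actP s a) = actR t a.
  rewrite /g; case: pickP => [b /eqP /(free_action_inj freeP) -> //|].
  by move=> /(_ a); rewrite eqxx.
have g_out x : x \notin free_orbit actP s -> g x = h x.
  rewrite /g; case: pickP => // a /eqP ->.
  by move=> /negP[]; apply/imsetP; exists a.
have stUs := stableD freeP (s := s) stU.
have orbE x : x \in U -> (exists a, x = actP s a) \/ x \in U :\: free_orbit actP s.
  move=> Ux; have [/imsetP[a _ ->] | out] := boolP (x \in free_orbit actP s).
    by left; exists a.
  by right; rewrite inE out.
have out_of x : x \in U :\: free_orbit actP s -> x \notin free_orbit actP s.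
  by case/setDP.
have [_ actPD _] := freeP; have [_ actRD _] := freeR.
exists g; split.
- move=> x /orbE[[a ->] | Ux].
    by rewrite g_orb stV // rRact rPact rt.
  by rewrite g_out ?out_of //; have [/setDP[]] := h_r x Ux.
- move=> x /orbE[[a ->] | Ux] b.
    by rewrite -actPD !g_orb actRD.
  by rewrite !g_out ?out_of ?stUs // h_act.
have hV x a : x \in U :\: free_orbit actP s -> h x <> actR t a.
  move=> /h_r[/setDP[_ /negP hx] _] eq_hx; apply: hx; rewrite eq_hx.
  by apply/imsetP; exists a.
move=> x y /orbE[[a ->] | Ux] /orbE[[b ->] | Uy]; rewrite ?g_orb.
- by move=> /(free_action_inj freeR) ->.
- by rewrite g_out ?out_of // => /esym /hV -/(_ Uy).
- by rewrite g_out ?out_of // => /hV -/(_ Ux).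
- by rewrite !g_out ?out_of //; apply: h_inj.
Qed.

End FreeActions.

(** * The group carrying the quandle *)

Lemma group_model_of_uniform_fibers (D : finZmodType) (phi : {additive D -> D})
    (P : finType) (act : P -> D -> P) (r : P -> D) (x0 : P) :
    free_action act -> (forall x a, r (act x a) = r x + phi a) ->
    (forall d d', #|[set x | r x == d]| = #|[set x | r x == d']|) ->
  exists (B : finZmodType) (j : {additive D -> B}) (psi : {additive B -> D})
      (h : P -> B),
    [/\ bijective h, forall d, psi (j d) = phi d,
        forall x a, h (act x a) = h x + j a & forall x, psi (h x) = r x].
Proof.
move=> act_free r_act r_unif.
have [B [j [psi [j_inj psi_j ker_psi psi_surj]]]] := surjective_extension phi.
have /dvdnP[k card_r] := dvdn_card_ker_fiber (r x0) act_free r_act.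
have k_gt0 : (0 < k)%N.
  rewrite lt0n; apply/eqP => k0; rewrite k0 mul0n in card_r.
  by have := cards0_eq card_r; move/setP/(_ x0); rewrite !inE eqxx.
have psi0 : psi 0 = 0 *+ k.-1.+1 by rewrite raddf0 mul0rn.
(* Multiplying [B] by [Z/k] adjusts the size of the fibres of [psi]. *)
pose C : finZmodType := cyclic_ext (0 : B) k.-1.
pose i : {additive B -> C} := @cyclic_ext_inj B 0 k.-1.
pose q : {additive C -> D} := cyclic_ext_lift psi0.
have qi b : q (i b) = psi b by exact: cyclic_ext_lift_inj.
have [|x a|y a|d|h [h_bij h_act h_q]] :=
  @equivariant_matching D P C act (fun y a => y + i (j a)) phi r q 0 act_free.
- split=> [y|y a b|y a]; first by rewrite !raddf0 addr0.
    by rewrite !raddfD addrA.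
  move/eqP; rewrite -subr_eq0 addrC addKr => /eqP[/eqP].
  by rewrite raddf_eq0 // => /eqP.
- exact: r_act.
- by rewrite raddfD qi psi_j.
- have [b psi_b] := psi_surj d.
  rewrite (r_unif d (r x0)) card_r -psi_b -qi card_fiber mulnC.
  rewrite -(card_imset _ j_inj).
  have -> : j @: [set a | phi a == 0] = [set b' | psi b' == 0].
    apply/setP=> b'; rewrite inE; apply/imsetP/eqP=> [[a] | /[dup] psib' /ker_psi].
      by rewrite inE => /eqP phia ->; rewrite psi_j.
    by case=> a b'a; exists a; rewrite // inE -psi_j -b'a psib'.
  have -> : [set u | q u == 0] = setX [set b' | psi b' == 0] [set: 'I_k.-1.+1].
    apply/setP=> -[b' c]; rewrite !inE andbT /q /= /cyclic_ext_lift /=.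
    by rewrite mul0rn addr0.
  by rewrite cardsX cardsT card_ord prednK.
exists C, (i \o j : {additive _ -> _}), q, h; split=> // a.
by rewrite /= qi psi_j.
Qed.

(** Turns a finite subgroup of a possibly infinite group into a type of its
own, so that finite cardinalities make sense on it. *)
Lemma finite_subgroup (A : zmodType) (s : seq A) :
    zmod_closed (mem s) ->
  exists (D : finZmodType) (i : {additive D -> A}),
    injective i /\ forall a, a \in s <-> exists d, i d = a.
Proof.
move=> s_closed.
pose zmodS := GRing.SubChoice_isSubZmodule.Build A (mem s) (seq_sub s) s_closed.
pose U : subZmodType (mem s) := HB.pack (seq_sub s) zmodS.
pose D : finZmodType := HB.pack (seq_sub s) zmodS.
pose i (d : D) : A := val d.
have i_morph : zmod_morphism i. by exact: (@GRing.valB A (mem s) U).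
pose iA : {additive D -> A} :=
  HB.pack i (GRing.isZmodMorphism.Build D A i i_morph).
exists D, iA.
split=> [|a]; first exact: val_inj.
by split=> [sa | [d <-]]; [exists (SeqSub sa) | exact: valP].
Qed.

(** * Subquandles of affine quandles *)

Section EmbeddedQuandle.

Variables (Q : finQuandleType) (A : zmodType) (f : {additive A -> A}) (e : Q -> A).
Hypothesis e_op : forall x y : Q, e (x |> y) = Aff_op f (e x) (e y).

(** [L_a L_b^-1] is the translation by [(1 - f) (e a - e b)]. *)
Lemma Dis_translation (alpha : {perm Q}) :
  alpha \in Dis Q -> exists c, forall z, e (alpha z) = e z + (c - f c).
Proof.
have trans1 a z : e (ltrans a z) = e a - f (e a) + f (e z).
  by rewrite permE e_op.
case/gen_prodgP=> n [g g_gen ->].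
elim/big_ind: _ => [|s t [c hs] [c' ht] | i _].
- by exists 0 => z; rewrite perm1 raddf0 subr0 addr0.
- exists (c + c') => z; rewrite permM ht hs raddfD opprD -addrA.
  by rewrite [c + c' + _]addrACA.
have /imsetP[[a b] _ ->] := g_gen i; exists (e a - e b) => z /=.
rewrite permM trans1 -[in RHS](permKV (ltrans b) z) trans1 raddfB.
by zmod_cancel.
Qed.

(** [z |> x0] is the image of [x0] under [L_z L_x0^-1]. *)
Lemma qop_in_orbit (x0 z : Q) : (z |> x0) \in qorbit x0.
Proof.
apply/orbitP; exists ((ltrans x0)^-1 * ltrans z)%g.
  by apply: mem_gen; apply/imsetP; exists (z, x0).
have L_x0 : ltrans x0 x0 = x0 by rewrite permE qopxx.
by rewrite /= /aperm permM -{2}L_x0 permK permE.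
Qed.

Lemma qorbit_translation (x0 y : Q) : y \in qorbit x0 ->
  exists2 alpha, alpha \in Dis Q & forall z, e (alpha z) = e z + (e y - e x0).
Proof.
case/orbitP=> alpha Dis_alpha <-; exists alpha => // z.
have [c h] := Dis_translation Dis_alpha.
by rewrite /= /aperm !h (addrC (e x0)) addrK.
Qed.

Definition orbit_differences (x0 : Q) : seq A :=
  [seq e y - e x0 | y in qorbit x0].

(** These differences are the translation vectors of the displacements, and
translations are composed by adding their vectors. *)
Lemma orbit_differences_closed (x0 : Q) : zmod_closed (mem (orbit_differences x0)).
Proof.
have sP y : y \in qorbit x0 -> e y - e x0 \in orbit_differences x0.
  exact: image_f.
split=> [|_ _ /imageP[y /= y_x0 ->] /imageP[z /= z_x0 ->]].
  by rewrite -(subrr (e x0)); apply/sP/orbit_refl.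
have [alpha Dis_alpha alphaE] := qorbit_translation y_x0.
have [beta Dis_beta betaE] := qorbit_translation z_x0.
have eE : e (alpha (beta^-1%g x0)) = e x0 + ((e y - e x0) - (e z - e x0)).
  by rewrite alphaE -[in RHS](permKV beta x0) betaE; zmod_cancel.
have /sP : alpha (beta^-1%g x0) \in qorbit x0.
  apply/orbitP; exists (beta^-1 * alpha)%g; first by rewrite groupM ?groupV.
  by rewrite /= /aperm permM.
by rewrite eE (addrC (e x0)) addrK.
Qed.

End EmbeddedQuandle.

(** In the affine quandle itself, translating [z] by [c] moves [z |> x] by
[c - f c], which maps the solutions for [y1] onto those for [y2] as soon as
[y2 - y1 = c - f c]. *)
Lemma affine_qmult (Q : finQuandleType) : affine Q ->
  forall x y1 y2 : Q, y1 \in qorbit x -> y2 \in qorbit x ->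
    qmult x y1 = qmult x y2.
Proof.
case=> A [f [f_bij [h [g hK gK] h_op]]] x y1 y2 y1_x y2_x.
have y_trans y : y \in qorbit x -> exists c, h y = h x + (c - f c).
  case/orbitP=> alpha Dis_alpha <-.
  by have [c hc] := Dis_translation h_op Dis_alpha; exists c; apply: hc.
have [[c1 hy1] [c2 hy2]] := (y_trans _ y1_x, y_trans _ y2_x).
pose s c (z : Q) : Q := g (h z + c).
have sK c : cancel (s c) (s (- c)) by move=> z; rewrite /s gK addrK hK.
rewrite /qmult -(card_imset _ (can_inj (sK (c2 - c1)))).
apply: eq_card => z; rewrite inE.
have {1}<- : s (c2 - c1) (s (- (c2 - c1)) z) = z.
  by rewrite -{1}(opprK (c2 - c1)) sK.
rewrite mem_imset ?inE; last exact: can_inj (sK _).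
rewrite -!(inj_eq (can_inj hK)) !h_op hy1 hy2 /= /qop /= /Aff_op gK.
have -> : h x + (c2 - f c2) = h x + (c1 - f c1) + (c2 - c1 - f (c2 - c1)).
  by rewrite (raddfB f); zmod_cancel.
rewrite -[in RHS]subr_eq !(raddfB f); congr (_ == _).
by zmod_cancel.
Qed.

Lemma quasi_affine_embedding (Q : quandleType) : quasi_affine Q ->
  exists (A : zmodType) (f : {additive A -> A}) (e : Q -> A),
    [/\ injective f, injective e &
      forall x y : Q, e (x |> y) = Aff_op f (e x) (e y)].
Proof.
case=> B [S [S_sub [[A [f [f_bij [h h_bij h_op]]]] [k k_bij k_op]]]].
exists A, f, (fun x => h (val (k x))); split.
- exact: bij_inj.
- by move=> x y /(bij_inj h_bij) /val_inj /(bij_inj k_bij).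
by move=> x y; rewrite k_op [val _](@val_subquandle_op _ _ S_sub) h_op.
Qed.

(** * The characterization *)

Lemma uniform_qmult_affine (Q : finQuandleType) (x0 : Q) :
    quasi_affine Q ->
    (forall y1 y2 : Q, y1 \in qorbit x0 -> y2 \in qorbit x0 ->
       qmult x0 y1 = qmult x0 y2) ->
  affine Q.
Proof.
move=> Q_qaff unif.
have [A [f [e [f_inj e_inj e_op]]]] := quasi_affine_embedding Q_qaff.
have [D [i [i_inj iP]]] := finite_subgroup (orbit_differences_closed e_op x0).
have iE d : exists2 y, y \in qorbit x0 & i d = e y - e x0.
  have /imageP[y /= y_x0 id] : i d \in orbit_differences e x0.
    by apply/iP; exists d.
  by exists y.
have iex y : y \in qorbit x0 -> exists d, i d = e y - e x0 
  by move=> y_x0; apply/iP/image_f.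
(* [i (r z)] is [(1 - f) (e z - e x0)], written inside the orbit of [x0]. *)
have [r rE] : exists r : Q -> D, forall z, i (r z) = e (z |> x0) - e x0.
  apply: (fin_all_exists (P := fun z d => i d = e (z |> x0) - e x0)) => z.
  exact/iex/qop_in_orbit.
have [actu actuE] : exists act : Q * D -> Q,
    forall u, e (act u) = e u.1 + i u.2.
  apply: (fin_all_exists (P := fun u z => e z = e u.1 + i u.2)) => -[z d].
  have [y y_x0 ->] := iE d; have [alpha _ h] := qorbit_translation e_op y_x0.
  by exists (alpha z); rewrite h.
pose act z d := actu (z, d).
have actE z d : e (act z d) = e z + i d by rewrite actuE.
have [phi0 phi0E] : exists phi : D -> D, forall d, i (phi d) = i d - f (i d).
  apply: (fin_all_exists (P := fun d d' => i d' = i d - f (i d))) => d.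
  have [y y_x0 ->] := iE d.
  exists (r y); by rewrite rE e_op /Aff_op raddfB; zmod_cancel.
have phi0_morph : zmod_morphism phi0.
  move=> a b; apply: i_inj; rewrite (raddfB i) !phi0E (raddfB i) (raddfB f).
  by zmod_cancel.
pose phi : {additive D -> D} :=
  HB.pack phi0 (GRing.isZmodMorphism.Build D D phi0 phi0_morph).
have phiE d : i (phi d) = i d - f (i d) := phi0E d.
have act_free : free_action act.
  split=> [z|z a b|z a].
  - by apply: e_inj; rewrite actE raddf0 addr0.
  - by apply: e_inj; rewrite !actE raddfD addrA.
  move/(congr1 e)/eqP; rewrite actE -subr_eq0 addrC addKr raddf_eq0 //.
  by move/eqP.
have r_act z a : r (act z a) = r z + phi a.
  apply: i_inj; rewrite raddfD !rE !e_op phiE actE /Aff_op raddfD.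
  by zmod_cancel.
have r_fiber d : exists2 y, y \in qorbit x0 & #|[set z | r z == d]| = qmult x0 y.
  have [y y_x0 id] := iE d; exists y => //; apply: eq_card => z; rewrite !inE.
  by rewrite -(inj_eq i_inj) rE id (inj_eq (addIr _)) (inj_eq e_inj).
have [|B [j [psi [h [h_bij psi_j h_act psi_h]]]]] :=
    group_model_of_uniform_fibers x0 act_free r_act.
  move=> d d'; have [y y_x0 ->] := r_fiber d; have [z z_x0 ->] := r_fiber d'.
  exact: unif.
pose g : {additive B -> B} := idfun \- (j \o psi).
(* If [g c = 0], then [c = j (psi c)] and so [f (i (psi c)) = 0]. *)
have g_bij : bijective g.
  apply: injF_bij => a b /eqP; rewrite -subr_eq0 -raddfB => /eqP.
  set c := a - b; rewrite /g /= => /eqP; rewrite subr_eq0 => /eqP c_j.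
  suff psi_c : psi c = 0 by apply/eqP; rewrite -subr_eq0 -/c c_j psi_c raddf0.
  apply: i_inj; apply: f_inj; rewrite !raddf0.
  have : i (psi c) - f (i (psi c)) = i (psi c) by rewrite -phiE -psi_j -c_j.
  by move/eqP; rewrite -subr_eq0 addrC addKr oppr_eq0 => /eqP.
exists B, g, g_bij, h => // a b.
have -> : a |> b = act b (r a - r b).
  by apply: e_inj; rewrite actE raddfB !rE !e_op /Aff_op; zmod_cancel.
rewrite h_act raddfB -!psi_h [RHS]/(Aff_op g _ _) /Aff_op /g /=.
by zmod_cancel.
Qed.

Theorem theorem6p3 (Q : finQuandleType) (Q_qaff : quasi_affine Q) :
  [<-> affine Q;
       forall x y1 y2 : Q, y1 \in qorbit x -> y2 \in qorbit x ->
         qmult x y1 = qmult x y2;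
       exists x : Q, forall y1 y2 : Q, y1 \in qorbit x -> y2 \in qorbit x ->
         qmult x y1 = qmult x y2].
Proof.
tfae.
- exact: affine_qmult.
- by move=> unif; have [x] := @quandle_nonempty Q; exists x; apply: unif.
by case=> x0; apply: uniform_qmult_affine.
Qed.
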